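(* Let $m$ and $N$ be integers with $0<m<N$ and let $\alpha$ be a positive real number. Define $$M(P)=\frac{\alpha}{1-\alpha(1-P)},\qquad f(P)=\lim_{P'\to P}\frac{\binom{N-1}{m}\left(M(P')\right)^m}{\sum_{X=0}^{m}\binom{N-1}{X}\left(M(P')\right)^X},$$ and let $P^\star$ be the unique element of $[0,1]$ with $f(P^\star)=P^\star$. If $\alpha\leq 1$, then for every $P_0\in[0,1]$ the sequence defined by Newton's method, $$P_n=P_{n-1}-\frac{f(P_{n-1})-P_{n-1}}{f'(P_{n-1})-1}\quad\text{for } n>0,$$ converges to $P^\star$.
   Context: $P$ and $P'$ are real variables. The limit in the definition of $f$ serves to remove the removable discontinuity at $P=1-1/\alpha$ (where the denominator of $M$ vanishes). The function $f$ may have nonremovable discontinuities (points at which the limit does not exist) at some negative values of $P$, where $f$ is left undefined. $f'$ denotes the derivative of $f$. A point $P^\star\in[0,1]$ with $f(P^\star)=P^\star$ exists and is unique. *)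

(* Defs.v *)
From mathcomp Require Import all_boot all_order all_algebra.
From mathcomp Require Import all_classical all_reals all_analysis.
Set Implicit Arguments.
Unset Strict Implicit.
Unset Printing Implicit Defensive.
Import Order.TTheory GRing.Theory Num.Theory.
Import numFieldNormedType.Exports.
Local Open Scope classical_set_scope.
Local Open Scope ring_scope.

Definition M (R : realType) (alpha P : R) : R :=
  alpha / (1 - alpha * (1 - P)).

(* Because division by 0 yields 0, the value of this ratio is meaningless where
   a denominator vanishes. These points are isolated, and the ratio is only
   used through its limits along the punctured neighborhoods P^'. *)
Definition ratio (R : realType) (m N : nat) (alpha P : R) : R :=
  'C(N.-1, m)%:R * M alpha P ^+ m /
  \sum_(0 <= X < m.+1) 'C(N.-1, X)%:R * M alpha P ^+ X.

(* [f] is a partial function with domain [f_defined]: outside this domain,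
   [lim] returns an arbitrary value. *)
Definition f_defined (R : realType) (m N : nat) (alpha P : R) : Prop :=
  cvg (ratio m N alpha P' @[P' --> P^']).

Definition f (R : realType) (m N : nat) (alpha P : R) : R :=
  lim (ratio m N alpha P' @[P' --> P^']).

(* The Newton step for f(P) - P at P makes sense: the partial function f is
   defined around P and differentiable at P, and the denominator f'(P) - 1 is
   nonzero. *)
Definition newton_defined (R : realType) (m N : nat) (alpha P : R) : Prop :=
  [/\ \forall Q \near P, f_defined m N alpha Q,
      derivable (f m N alpha) P 1 &
      derive1 (f m N alpha) P - 1 != 0].

(* Main.v *)
Require Import Defs.
From mathcomp Require Import all_boot all_order all_algebra.
From mathcomp Require Import all_classical all_reals all_analysis.
From mathcomp Require Import ring lra zify.
Import Order.TTheory GRing.Theory Num.Theory.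
Import numFieldNormedType.Exports.
Local Open Scope classical_set_scope.
Local Open Scope ring_scope.

(** Put [n = N - 1] and [u = P + (1/alpha - 1)]. Then [M = 1/u], and
    multiplying the numerator and the denominator of the ratio by [u^m] gives
    [f(P) = 'C(n, m) / D(u)], where [D(u)] is the sum of the ['C(n, m - j) u^j]
    for [j <= m]. This form has no singularity at [u = 0]. The hypothesis
    [alpha <= 1] says that [P >= 0] implies [u >= 0], where the polynomial [D],
    having nonnegative coefficients and a positive constant term, is positive.

    The main point is that [f] is convex on [[0, +oo[]. Since
    [(1/D)'' = (2 D'^2 - D D'') / D^3], it is enough that [2 D'^2 - D D''] has
    nonnegative coefficients ([log_concave_deriv_ge0]). Up to a factor and a
    shift, its coefficients are sums over [i] of [d_i d_(s-i)] weighted by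
    [6 i (s - i) - s (s - 1)]. These weights have sum zero and increase towards
    the middle index; the products [d_i d_(s-i)] also increase towards the
    middle because the binomial coefficients are log-concave. Chebyshev's sum
    inequality then shows that the weighted sum is nonnegative.

    Thus [f] is nonnegative, nonincreasing and convex on [[0, +oo[], and for
    such functions Newton's method for [f(P) = P] converges from every
    [P0 >= 0] ([newton_convex_fixpoint]). The iterates remain nonnegative
    because the tangent to [f] at a point [P >= 0] has slope at most [0] and is
    nonnegative at [0], so that it meets the diagonal at a point with
    nonnegative coordinates. By convexity the tangent lies below [f], so all
    iterates but the first are at most [Pstar]; from there each step removes at
    least the fraction [1 / (1 - f'(0))] of the error, so convergence is at
    least geometric. *)

(** * Log-concave sequences *)

(** The inequality is required for all [i <= j] and not only for [j = i + 1]: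
    for nonnegative sequences this adds that there are no internal zeros. *)
Definition log_concave {R : realFieldType} (d : nat -> R) : Prop :=
  forall i j, (i <= j)%N -> d i * d j.+1 <= d i.+1 * d j.

Lemma log_concave_unimodal {R : realFieldType} (d : nat -> R) (s k i : nat) :
  log_concave d -> (k <= i)%N -> (2 * i <= s)%N ->
  d k * d (s - k)%N <= d i * d (s - i)%N.
Proof.
move=> lcd; elim: i => [|i IH]; first by rewrite leqn0 => /eqP ->.
rewrite leq_eqVlt => /predU1P[-> //|ki] is_.
apply: le_trans (IH _ _) _; [lia..|].
have -> : (s - i = (s - i.+1).+1)%N by lia.
by apply: lcd; lia.
Qed.

(** Both sides differ by half the sum of [(a i - a k) * (w i - w k)] over all
    pairs of indices. *)
Lemma chebyshev_sum {R : realFieldType} (n : nat) (a w : nat -> R) :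
  (forall i k, (i < n)%N -> (k < n)%N -> 0 <= (a i - a k) * (w i - w k)) ->
  (\sum_(i < n) a i) * (\sum_(i < n) w i) <= n%:R * \sum_(i < n) a i * w i.
Proof.
move=> aw.
have : 0 <= \sum_(i < n) \sum_(k < n) (a i - a k) * (w i - w k).
  by apply: sumr_ge0 => i _; apply: sumr_ge0 => k _; apply: aw.
suff -> : \sum_(i < n) \sum_(k < n) (a i - a k) * (w i - w k) =
  2 * (n%:R * (\sum_(i < n) a i * w i) -
       (\sum_(i < n) a i) * (\sum_(i < n) w i)).
  by rewrite pmulr_rge0 ?ltr0n// subr_ge0.
pose A := \sum_(i < n) a i; pose W := \sum_(i < n) w i.
pose S := \sum_(i < n) a i * w i.
have inner (i : 'I_n) : \sum_(k < n) (a i - a k) * (w i - w k) =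
    (a i * w i) *+ n - a i * W - w i * A + S.
  rewrite /W /A /S !mulr_sumr -[X in _ *+ X]card_ord -sumr_const.
  by rewrite -!sumrB -big_split /=; apply: eq_bigr => k _; ring.
under eq_bigr do rewrite inner.
rewrite !(big_split, sumrB) /= sumrN -!mulr_suml sumr_const card_ord sumrN.
rewrite -mulr_suml sumrMnl -/S -/A -/W; ring.
Qed.

Lemma sum_mul_sub {R : comRingType} (t : R) (n : nat) :
  6 * (\sum_(i < n) i%:R * (t - i%:R)) =
  n%:R * (n%:R - 1) * (3 * t - 2 * n%:R + 1).
Proof.
elim: n => [|n IH]; first by rewrite big_ord0; ring.
by rewrite big_ord_recr /= mulrDr IH -natr1; ring.
Qed.

(** The weights have sum zero, so Chebyshev's inequality gives the sign once
    weights and products are seen to be similarly ordered. Both are invariant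
    under [i |-> s - i], so it suffices to compare them for indices at most
    [s / 2], where both increase. *)
Lemma log_concave_convolution {R : realFieldType} (d : nat -> R) (s : nat) :
  log_concave d ->
  0 <= \sum_(i < s.+1) d i * d (s - i)%N *
    (6 * (i%:R * (s%:R - i%:R)) - s%:R * (s%:R - 1)).
Proof.
move=> lcd.
pose a i := d i * d (s - i)%N.
pose w i : R := 6 * (i%:R * (s%:R - i%:R)) - s%:R * (s%:R - 1).
have w0 : \sum_(i < s.+1) w i = 0.
  rewrite sumrB -mulr_sumr sum_mul_sub sumr_const card_ord.
  by rewrite -mulr_natr -natr1; ring.
have aw i k : (i < s.+1)%N -> (k < s.+1)%N ->
    0 <= (a i - a k) * (w i - w k).
  (* [fold] sends an index to its representative in the lower half *)
  pose fold i := minn i (s - i).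
  have foldE j : (j < s.+1)%N ->
      [/\ a j = a (fold j), w j = w (fold j) & (2 * fold j <= s)%N].
    move=> js; rewrite /fold; case: (leqP j (s - j)) => h.
      by split=> //; lia.
    have ssj : (s - (s - j) = j)%N by lia.
    split; [by rewrite /a ssj mulrC| |lia].
    by rewrite /w natrB; [ring|lia].
  move=> /foldE[-> -> ile] /foldE[-> -> kle].
  move: (fold i) (fold k) ile kle => {}i {}k ile kle.
  wlog ki : i k ile kle / (k <= i)%N.
    move=> H; case: (leqP k i) => [|/ltnW] ki; first exact: H.
    by rewrite -mulrNN (opprB (a i)) (opprB (w i)); apply: H.
  apply: mulr_ge0; rewrite subr_ge0; first exact: log_concave_unimodal.
  have kiR : k%:R <= i%:R :> R by rewrite ler_nat.
  have iks : i%:R + k%:R <= s%:R :> R by rewrite -natrD ler_nat; lia.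
  rewrite -subr_ge0.
  have -> : w i - w k = 6 * ((i%:R - k%:R) * (s%:R - i%:R - k%:R)).
    by rewrite /w; ring.
  by rewrite !mulr_ge0 ?subr_ge0//; lra.
have := chebyshev_sum s.+1 a w aw.
by rewrite w0 mulr0 pmulr_rge0 ?ltr0n.
Qed.

(** * Reciprocals of polynomials with log-concave coefficients *)

(** After multiplication by [2 'X^2], the derivatives become the Euler-type
    operators [p`_i |-> i p`_i] and [p`_i |-> i (i - 1) p`_i], and writing
    [2 p p''] as [p p'' + p'' p] makes the weight
    [4 i j - i (i - 1) - j (j - 1)] symmetric; with [i + j = s] it is the weight
    of [log_concave_convolution]. *)
Lemma log_concave_deriv_ge0 {R : realFieldType} (p : {poly R}) :
  log_concave (fun i => p`_i) ->
  forall k, 0 <= (2 * (p^`() * p^`()) - p * p^`()^`())`_k.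
Proof.
move=> lcp k.
set q := 2 * _ - _.
pose e1 := 'X * p^`(); pose e2 := 'X^2 * p^`()^`().
have e1E i : e1`_i = i%:R * p`_i.
  rewrite coefXM coef_deriv; case: i => [|i] /=; first by rewrite mul0r.
  by rewrite mulr_natl.
have e2E i : e2`_i = i%:R * (i%:R - 1) * p`_i.
  rewrite coefXnM !coef_deriv; case: i => [|[|i]] /=; rewrite ?mul0r ?subrr
    ?mulr0 ?mul0r//.
  rewrite subn2 /= -mulrnA -[LHS]mulr_natr natrM -!natr1; ring.
have qE : 'X^2 * (2 * q) = 4 * (e1 * e1) - p * e2 - e2 * p.
  by rewrite /q /e1 /e2; ring.
have -> : q`_k = 2^-1 * (4 * (e1 * e1) - p * e2 - e2 * p)`_k.+2.
  rewrite -qE coefXnM /= subn2 /= (mulr_natl q) coefMn.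
  rewrite -[q`_k *+ 2]mulr_natl mulrA.
  by rewrite mulVf ?mul1r// pnatr_eq0.
rewrite mulr_ge0 ?invr_ge0// !coefB (mulr_natl _ 4) coefMn !coefM.
rewrite -mulr_natl mulr_sumr -!sumrB.
have := log_concave_convolution _ k.+2 lcp; congr (0 <= _).
apply: eq_bigr => i _; rewrite !e1E !e2E natrB; first by ring.
by rewrite -ltnS.
Qed.

Lemma log_concave_horner_deriv_le {R : realFieldType} (p : {poly R}) (x : R) :
  log_concave (fun i => p`_i) -> 0 <= x ->
  p.[x] * p^`()^`().[x] <= 2 * p^`().[x] ^+ 2.
Proof.
move=> lcp x0; rewrite -subr_ge0.
have -> : 2 * p^`().[x] ^+ 2 - p.[x] * p^`()^`().[x] =
    (2 * (p^`() * p^`()) - p * p^`()^`()).[x].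
  by rewrite !(hornerE, hornerMn).
rewrite horner_coef sumr_ge0// => i _.
by rewrite mulr_ge0 ?exprn_ge0 ?log_concave_deriv_ge0.
Qed.

Lemma horner_ge0 {R : realFieldType} (p : {poly R}) (x : R) :
  (forall i, 0 <= p`_i) -> 0 <= x -> 0 <= p.[x].
Proof.
by move=> p0 x0; rewrite horner_coef sumr_ge0// => i _; rewrite mulr_ge0 ?exprn_ge0.
Qed.

Lemma horner_gt0 {R : realFieldType} (p : {poly R}) (x : R) :
  (forall i, 0 <= p`_i) -> 0 < p`_0 -> 0 <= x -> 0 < p.[x].
Proof.
move=> pi0 p0 x0; rewrite (lt_le_trans p0)// horner_coef.
case E : (size p) => [|k]; first by rewrite nth_default ?E// ltxx in p0.
rewrite big_ord_recl /= expr0 mulr1 lerDl sumr_ge0// => i _.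
by rewrite mulr_ge0 ?exprn_ge0.
Qed.

Lemma coef_deriv_ge0 {R : realFieldType} (p : {poly R}) :
  (forall i, 0 <= p`_i) -> forall i, 0 <= p^`()`_i.
Proof. by move=> p0 i; rewrite coef_deriv mulrn_wge0. Qed.

Lemma is_derive_inv_horner {R : realType} (p : {poly R}) (x : R) :
  p.[x] != 0 ->
  is_derive x 1 (fun y : R => (p.[y])^-1) (- (p^`().[x] / p.[x] ^+ 2)).
Proof.
move=> px; have := is_deriveV px (is_derive_poly p x).
by rewrite scaleNr /GRing.scale /= mulrC.
Qed.

(** This is the convexity of [1/p] on [[0, +oo[]. *)
Lemma inv_horner_deriv_homo {R : realType} (p : {poly R}) :
  (forall i, 0 <= p`_i) -> 0 < p`_0 -> log_concave (fun i => p`_i) ->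
  forall x y : R, 0 <= x -> x <= y ->
  - (p^`().[x] / p.[x] ^+ 2) <= - (p^`().[y] / p.[y] ^+ 2).
Proof.
move=> pi0 p0 lcp.
pose g x : R := - (p^`().[x] / p.[x] ^+ 2).
pose dg x : R := (2 * p^`().[x] ^+ 2 - p.[x] * p^`()^`().[x]) / p.[x] ^+ 3.
have Dg (x : R) : 0 <= x -> is_derive x 1 g (dg x).
  move=> x0; have px := horner_gt0 _ _ pi0 p0 x0.
  have p2x : (p ^+ 2).[x] != 0 by rewrite horner_exp expf_neq0// gt_eqF.
  have -> : g = - (horner p^`() * (fun y => (p ^+ 2).[y]^-1)).
    by apply/funext => y; rewrite /g !fctE horner_exp.
  have Di := is_derive_inv_horner _ _ p2x.
  apply: is_derive_eq.
  have -> : (p ^+ 2)^`() = p * p^`() + p * p^`() by rewrite expr2 derivM; ring.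
  rewrite /dg /GRing.scale /= !(hornerD, hornerM, horner_exp).
  by field; rewrite gt_eqF.
apply: ger0_derive1_ndecry.
- by move=> x; rewrite in_itv/= andbT => /ltW/Dg[].
- move=> x; rewrite in_itv/= andbT => /ltW x0.
  rewrite derive1E; have [_ ->] := Dg _ x0.
  by rewrite divr_ge0 ?exprn_ge0 ?horner_ge0// subr_ge0 log_concave_horner_deriv_le.
- apply: derivable_within_continuous => x; rewrite in_itv/= andbT => x0.
  by have [] := Dg _ x0.
Qed.

(** * Newton's method for the fixed point of a convex function *)

Lemma le_tangent {R : realType} (F dF : R -> R) :
  (forall x : R, 0 <= x -> is_derive x 1 F (dF x)) ->
  (forall x y : R, 0 <= x -> x <= y -> dF x <= dF y) ->
  forall x y : R, 0 <= x -> 0 <= y -> F x + dF x * (y - x) <= F y.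
Proof.
move=> FdF dF_homo x y x0 y0.
have cF (a b : R) : 0 <= a -> {within `[a, b], continuous F}.
  move=> a0; apply: derivable_within_continuous => z.
  rewrite in_itv /= => /andP[az _].
  by have [] := FdF z (le_trans a0 az).
have FdFI (a b : R) : 0 <= a ->
    forall z : R, z \in `]a, b[ -> is_derive z 1 F (dF z).
  move=> a0 z; rewrite in_itv /= => /andP[az _].
  by apply/FdF/(le_trans a0 (ltW az)).
case: (leP x y) => [xy|/ltW yx].
  have [c] := MVT_segment xy (FdFI _ _ x0) (cF _ _ x0).
  rewrite in_itv /= => /andP[xc _] /eqP; rewrite subr_eq => /eqP ->.
  by rewrite addrC lerD2r ler_wpM2r ?subr_ge0 ?dF_homo.
have [c] := MVT_segment yx (FdFI _ _ y0) (cF _ _ y0).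
rewrite in_itv /= => /andP[yc cx] E.
have -> : F y = F x + dF c * (y - x) by rewrite -[y - x]opprB mulrN -E; ring.
by rewrite lerD2l ler_wnM2r ?subr_le0// dF_homo// (le_trans y0).
Qed.

(** Each step goes to the point where a tangent to [F] meets the diagonal. The
    tangent is nonincreasing, nonnegative at [0], and below [F], so this point
    is in [[0, p]] even if the step starts to the right of [p]. On [[0, p]] the
    slopes are at least [dF 0], which gives a geometric rate. *)
Lemma newton_convex_fixpoint {R : realType} (F dF : R -> R) (p : R)
    (x : nat -> R) :
  (forall y : R, 0 <= y -> is_derive y 1 F (dF y)) ->
  (forall y : R, 0 <= y -> 0 <= F y) ->
  (forall y : R, 0 <= y -> dF y <= 0) ->
  (forall y z : R, 0 <= y -> y <= z -> dF y <= dF z) ->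
  0 <= p -> F p = p -> 0 <= x 0%N ->
  (forall n, x n.+1 = x n - (F (x n) - x n) / (dF (x n) - 1)) ->
  (forall n, 0 <= x n) /\ x n @[n --> \oo] --> p.
Proof.
move=> FdF F0 dF0 dF_homo p0 Fp x0 xS.
have tangent := le_tangent _ _ FdF dF_homo.
have step n : 0 <= x n -> (1 - dF (x n)) * x n.+1 = F (x n) - dF (x n) * x n.
  move=> xn; rewrite xS; field.
  by have := dF0 _ xn; lra.
have x_ge0 n : 0 <= x n.
  elim: n => // n xn.
  have d1 : 0 < 1 - dF (x n) by have := dF0 _ xn; lra.
  rewrite -(pmulr_rge0 _ d1) step// subr_ge0.
  by rewrite (@le_trans _ _ 0) ?F0// mulr_le0_ge0// dF0.
(* the tangent at [x n] lies below [F], so at [p] it is below the diagonal *)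
have x_lep n : x n.+1 <= p.
  have d1 : 0 < 1 - dF (x n) by have := dF0 _ (x_ge0 n); lra.
  rewrite -(ler_pM2l d1) step//.
  by have := tangent _ _ (x_ge0 n) p0; rewrite Fp; lra.
pose K := - dF 0.
have K0 : 0 <= K by rewrite oppr_ge0 dF0.
pose q := K / (1 + K).
have q0 : 0 <= q by rewrite divr_ge0// addr_ge0.
have q1 : q < 1 by rewrite ltr_pdivrMr; lra.
(* [1 - dF] is at most [1 + K] at every iterate, since [dF] is nondecreasing;
   as [p <= F (x n)] to the left of [p], each step covers at least the fraction
   [1 / (1 + K)] of the distance to [p] *)
have contract n : p - x n.+2 <= q * (p - x n.+1).
  have xn := x_ge0 n.+1.
  have d0 := dF0 _ xn; have dK := dF_homo _ _ (lexx 0) xn.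
  have Fx : p <= F (x n.+1).
    have := tangent _ _ p0 xn; rewrite Fp; apply: le_trans.
    by rewrite lerDl mulr_le0// ?dF0// subr_le0.
  have d1 : 0 < 1 - dF (x n.+1) by lra.
  have gap : p - x n.+1 <= (1 - dF (x n.+1)) * (x n.+2 - x n.+1).
    by rewrite mulrBr step//; lra.
  have gap0 : 0 <= x n.+2 - x n.+1.
    by rewrite -(pmulr_rge0 _ d1) (le_trans _ gap)// subr_ge0.
  have gapK : p - x n.+1 <= (1 + K) * (x n.+2 - x n.+1).
    by rewrite (le_trans gap)// ler_wpM2r// /K; lra.
  have K1 : 0 < 1 + K by lra.
  rewrite -(ler_pM2l K1) /q mulrA [(1 + K) * (K / _)]mulrC divfK ?gt_eqF//.
  by lra.
have geo n : p - x n.+1 <= geometric (p - x 1%N) q n.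
  elim: n => [|n IH]; first by rewrite /= expr0 mulr1.
  apply: le_trans (contract n) _; rewrite /= exprS mulrCA.
  by rewrite ler_wpM2l.
split=> //; rewrite -(cvg_shiftS x).
apply: (@squeeze_cvgr _ _ _ _ (fun n => p - geometric (p - x 1%N) q n) (cst p)).
- by near=> n; rewrite x_lep andbT lerBlDr -lerBlDl geo.
- rewrite -[X in _ --> X]subr0; apply: cvgB; first exact: cvg_cst.
  by apply: cvg_geometric; rewrite ger0_norm.
- exact: cvg_cst.
Unshelve. all: by end_near. Qed.

(** * The truncated binomial sum *)

(** The truncation of [(1 + 'X)^n] to degree [m], with its coefficients
    reversed. It arises when the truncated sum at [M] is divided by [M^m] and
    written in the variable [1 / M]. *)
Definition truncated_binomial (R : realType) (n m : nat) : {poly R} :=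
  \poly_(j < m.+1) 'C(n, m - j)%:R.

(** With [a = m - i - 1] and [b = m - j - 1], passing from
    ['C(n, a + 1) 'C(n, b)] to ['C(n, a) 'C(n, b + 1)] multiplies by
    [(n - b) (a + 1) / ((n - a) (b + 1))], which is at least [1] for
    [b <= a < n]. *)
Lemma log_concave_binomial {R : realFieldType} (n m : nat) :
  log_concave (fun j => if (j < m.+1)%N then 'C(n, m - j)%:R else 0 : R).
Proof.
move=> i j ij; rewrite !ltnS; case: (ltnP j m) => jm; last first.
  by rewrite mulr0 mulr_ge0//; case: ifP.
rewrite (ltnW jm) (leq_ltn_trans ij jm) (leq_trans ij (ltnW jm)).
rewrite -!natrM ler_nat.
have -> : (m - i = (m - i.+1).+1)%N by lia.
have -> : (m - j = (m - j.+1).+1)%N by lia.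
have : (m - j.+1 <= m - i.+1)%N by lia.
move: (m - j.+1)%N (m - i.+1)%N => b a ba.
rewrite -(@leq_pmul2l (a.+1 * b.+1))//.
have -> : (a.+1 * b.+1 * ('C(n, a.+1) * 'C(n, b)) =
   (n - a) * b.+1 * ('C(n, a) * 'C(n, b)))%N.
  by rewrite mulnACA mul_bin_left; ring.
have -> : (a.+1 * b.+1 * ('C(n, a) * 'C(n, b.+1)) =
   a.+1 * (n - b) * ('C(n, a) * 'C(n, b)))%N.
  by rewrite mulnACA mul_bin_left; ring.
by rewrite leq_mul2r orbC mulnC leq_mul//; lia.
Qed.

Lemma truncated_binomial_coef (R : realType) n m j :
  (truncated_binomial R n m)`_j =
    if (j < m.+1)%N then 'C(n, m - j)%:R else 0.
Proof. exact: coef_poly. Qed.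

Lemma truncated_binomial_ge0 (R : realType) n m j :
  0 <= (truncated_binomial R n m)`_j.
Proof. by rewrite truncated_binomial_coef; case: ifP. Qed.

Lemma truncated_binomial_log_concave (R : realType) n m :
  log_concave (fun j => (truncated_binomial R n m)`_j).
Proof.
by move=> i j ij; rewrite !truncated_binomial_coef; exact: log_concave_binomial.
Qed.

Lemma sum_truncated_binomial {R : realType} (n m : nat) (u : R) : u != 0 ->
  \sum_(0 <= X < m.+1) 'C(n, X)%:R * u^-1 ^+ X =
    u^-1 ^+ m * (truncated_binomial R n m).[u].
Proof.
move=> u0; rewrite horner_poly mulr_sumr big_mkord (reindex_inj rev_ord_inj) /=.
apply: eq_bigr => i _; rewrite subSS mulrCA; congr (_ * _).
have im : (i <= m)%N by rewrite -ltnS.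
by rewrite -[X in _ = u^-1 ^+ X * _](subnK im) exprD -mulrA
  -exprMn mulVf// expr1n mulr1.
Qed.

(** * The function f *)

(** The point [P + (alpha^-1 - 1) = 0] is the removable singularity: there the
    convention [0^-1 = 0] makes [M], and for [0 < m] also the ratio, equal to
    [0], while the right-hand side is [1] when [m < N]. *)
Lemma ratioE {R : realType} (m N : nat) (alpha P : R) :
  alpha != 0 -> P + (alpha^-1 - 1) != 0 ->
  Defs.ratio m N alpha P =
    'C(N.-1, m)%:R / (truncated_binomial R N.-1 m).[P + (alpha^-1 - 1)].
Proof.
move=> a0; set u := P + _ => u0.
have ME : M alpha P = u^-1.
  have -> : M alpha P = alpha / (alpha * u).
    by rewrite /M; congr (_ / _); rewrite /u; field.
  by rewrite invfM mulrA divff// mul1r.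
rewrite /Defs.ratio ME sum_truncated_binomial// invfM mulrA mulfK//.
by rewrite expf_neq0// invr_eq0.
Qed.

Lemma near_dnbhs_neq {R : realType} (x a : R) : \forall y \near x^', y != a.
Proof.
have [->|xa] := eqVneq x a; first exact: nbhs_dnbhs_neq.
apply: nbhs_dnbhs; apply: open_nbhs_nbhs; split => //; exact: open_neq.
Qed.

Section regular_points.
Context {R : realType} (m N : nat) (alpha : R).
Hypothesis alpha_neq0 : alpha != 0.
Let D := truncated_binomial R N.-1 m.
Let c := alpha^-1 - 1.

Lemma is_derive_binomial_ratio (P : R) : D.[P + c] != 0 ->
  is_derive P 1 (fun Q : R => 'C(N.-1, m)%:R / D.[Q + c])
    ('C(N.-1, m)%:R * - (D^`().[P + c] / D.[P + c] ^+ 2)).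
Proof.
move=> DP.
have H := @is_derive1_comp R (fun y => D.[y]^-1) (shift c) P _ _
  (is_derive_inv_horner _ _ DP) (is_derive_shift P 1 c).
have -> : (fun Q : R => 'C(N.-1, m)%:R / D.[Q + c]) =
  'C(N.-1, m)%:R \*: ((fun y : R => D.[y]^-1) \o shift c) by [].
by apply: is_derive_eq; rewrite /GRing.scale /= mulr1.
Qed.

Lemma ratio_cvg (P : R) : D.[P + c] != 0 ->
  Defs.ratio m N alpha Q @[Q --> P^'] --> 'C(N.-1, m)%:R / D.[P + c].
Proof.
move=> DP.
have cF : 'C(N.-1, m)%:R / D.[Q + c] @[Q --> P^'] -->
          'C(N.-1, m)%:R / D.[P + c].
  apply/(continuous_withinNx (fun Q : R => 'C(N.-1, m)%:R / D.[Q + c])).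
  apply/differentiable_continuous/derivable1_diffP.
  by have [] := is_derive_binomial_ratio _ DP.
apply: cvg_trans cF; apply: near_eq_cvg.
near=> Q; rewrite ratioE//.
rewrite -[_ - 1]opprK subr_eq0; near: Q; exact: near_dnbhs_neq.
Unshelve. all: by end_near. Qed.

Lemma fE (P : R) :
  D.[P + c] != 0 -> f m N alpha P = 'C(N.-1, m)%:R / D.[P + c].
Proof. by move=> /ratio_cvg; apply: cvg_lim. Qed.

Lemma near_regular (P : R) : D.[P + c] != 0 ->
  \forall Q \near P, D.[Q + c] != 0.
Proof.
move=> DP.
have DcE Q : D.[Q + c] = (D \Po ('X + c%:P)).[Q] by rewrite horner_comp !hornerE.
rewrite DcE in DP; have cD := @continuous_horner R (D \Po ('X + c%:P)) P.
by apply: filterS (cvgr_neq0 _ cD DP) => Q; rewrite DcE.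
Qed.

Lemma is_derive_f (P : R) : D.[P + c] != 0 ->
  is_derive P 1 (f m N alpha)
    ('C(N.-1, m)%:R * - (D^`().[P + c] / D.[P + c] ^+ 2)).
Proof.
move=> DP; apply: near_eq_is_derive (is_derive_binomial_ratio _ DP).
by apply: filterS (near_regular _ DP) => Q /fE.
Qed.

Lemma newton_defined_regular (P : R) : D.[P + c] != 0 ->
  derive1 (f m N alpha) P <= 0 -> newton_defined m N alpha P.
Proof.
move=> DP f'0; split.
- apply: filterS (near_regular _ DP) => Q /ratio_cvg; exact: cvgP.
- by have [] := is_derive_f _ DP.
- by rewrite lt_eqF// subr_lt0 (le_lt_trans f'0).
Qed.

End regular_points.

Theorem theorem6 (R : realType) (m N : nat) (alpha Pstar : R)
    (m_gt0 : (0 < m)%N) (m_ltN : (m < N)%N) (alpha_gt0 : 0 < alpha)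
    (Pstar_ge0 : 0 <= Pstar) (Pstar_le1 : Pstar <= 1)
    (Pstar_fixed : f m N alpha Pstar = Pstar)
    (alpha_le1 : alpha <= 1)
    (P0 : R) (P0_ge0 : 0 <= P0) (P0_le1 : P0 <= 1)
    (P : nat -> R) (P_0 : P 0%N = P0)
    (P_newton : forall n : nat, (0 < n)%N ->
       P n = P n.-1 - (f m N alpha (P n.-1) - P n.-1) /
                      (derive1 (f m N alpha) (P n.-1) - 1)) :
  (forall n : nat, newton_defined m N alpha (P n)) /\
  P n @[n --> \oo] --> Pstar.
Proof.
pose D := truncated_binomial R N.-1 m; pose c := alpha^-1 - 1.
have alpha_neq0 : alpha != 0 by rewrite gt_eqF.
have c0 : 0 <= c by rewrite subr_ge0 invf_ge1.
have Dge0 := @truncated_binomial_ge0 R N.-1 m.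
have D0 : 0 < D`_0.
  by rewrite truncated_binomial_coef /= subn0 ltr0n bin_gt0; lia.
have Dgt0 y : 0 <= y -> 0 < D.[y + c].
  by move=> y0; rewrite horner_gt0// addr_ge0.
have Dneq0 y : 0 <= y -> D.[y + c] != 0 by move=> /Dgt0; rewrite lt0r => /andP[].
have df (y : R) : 0 <= y -> is_derive y 1 (f m N alpha)
    ('C(N.-1, m)%:R * - (D^`().[y + c] / D.[y + c] ^+ 2)).
  by move=> y0; apply: is_derive_f => //; exact: Dneq0.
have f'E y : 0 <= y -> derive1 (f m N alpha) y =
    'C(N.-1, m)%:R * - (D^`().[y + c] / D.[y + c] ^+ 2).
  by move=> /df[_ <-]; rewrite derive1E.
have f'le0 y : 0 <= y -> derive1 (f m N alpha) y <= 0.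
  move=> y0; rewrite f'E// mulr_ge0_le0// oppr_le0.
  rewrite divr_ge0 ?exprn_ge0 ?(ltW (Dgt0 _ y0))//.
  by apply: horner_ge0; [exact: coef_deriv_ge0|exact: addr_ge0].
have [Pge0 Pcvg] : (forall n, 0 <= P n) /\ P n @[n --> \oo] --> Pstar.
  apply: (@newton_convex_fixpoint R (f m N alpha) (derive1 (f m N alpha))
    Pstar P _ _ f'le0 _ Pstar_ge0 Pstar_fixed).
  - by move=> y y0; rewrite f'E//; exact: df.
  - by move=> y y0; rewrite fE ?Dneq0// divr_ge0 ?(ltW (Dgt0 _ y0)).
  - move=> y z y0 yz; have z0 := le_trans y0 yz.
    rewrite (f'E y)// (f'E z)// ler_wpM2l//.
    apply: inv_horner_deriv_homo.
    + exact: Dge0.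
    + exact: D0.
    + exact: truncated_binomial_log_concave.
    + exact: addr_ge0.
    + by rewrite lerD2r.
  - by rewrite P_0.
  - by move=> n; rewrite P_newton.
split; last exact: Pcvg.
by move=> n; apply: newton_defined_regular; [|exact: Dneq0|exact: f'le0].
Qed.
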